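(* If a sequent $A \vdash_{\mathsf{L}} B$ is derivable in $\mathtt{SkMBiCA}$, then it is valid in every $\mathtt{SkMBiCA}$ model, i.e. $v(A) \subseteq v(B)$ for every $\mathtt{SkMBiCA}$ model $\langle W,\leq,\mathbb{I},\mathbb{L},\mathbb{R},v\rangle$.
   Context: Formulae are generated by $A,B ::= X \mid \mathsf{I} \mid A \otimes^{\mathsf{L}} B \mid A \multimap^{\mathsf{L}} B \mid A \otimes^{\mathsf{R}} B \mid A \multimap^{\mathsf{R}} B$, with $X$ ranging over a set of atoms. $\mathtt{SkMBiCA}$ has sequents $A \vdash_{\mathsf{L}} B$ generated by: (id) $A\vdash_{\mathsf{L}} A$; (comp) from $A \vdash_{\mathsf{L}} B$ and $B \vdash_{\mathsf{L}} C$ infer $A \vdash_{\mathsf{L}} C$; ($\otimes^{\mathsf{L}}$) from $A\vdash_{\mathsf{L}} C$, $B \vdash_{\mathsf{L}} D$ infer $A\otimes^{\mathsf{L}} B \vdash_{\mathsf{L}} C \otimes^{\mathsf{L}} D$; ($\multimap^{\mathsf{L}}$) from $C \vdash_{\mathsf{L}} A$, $B \vdash_{\mathsf{L}} D$ infer $A\multimap^{\mathsf{L}} B \vdash_{\mathsf{L}} C\multimap^{\mathsf{L}} D$; ($\multimap^{\mathsf{R}}$) from $C \vdash_{\mathsf{L}} A$, $B \vdash_{\mathsf{L}} D$ infer $A\multimap^{\mathsf{R}} B \vdash_{\mathsf{L}} C\multimap^{\mathsf{R}} D$; axioms ($\lambda$) $\mathsf{I}\otimes^{\mathsf{L}} A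 \vdash_{\mathsf{L}} A$, ($\rho$) $A \vdash_{\mathsf{L}} A \otimes^{\mathsf{L}} \mathsf{I}$, ($\alpha$) $(A\otimes^{\mathsf{L}} B)\otimes^{\mathsf{L}} C \vdash_{\mathsf{L}} A \otimes^{\mathsf{L}}(B\otimes^{\mathsf{L}} C)$, ($\gamma$) $A \otimes^{\mathsf{L}} B \vdash_{\mathsf{L}} B \otimes^{\mathsf{R}} A$, ($\gamma^{-1}$) $A \otimes^{\mathsf{R}} B \vdash_{\mathsf{L}} B \otimes^{\mathsf{L}} A$; bidirectional rules ($\pi$) $A \vdash_{\mathsf{L}} B \multimap^{\mathsf{L}} C$ iff $A \otimes^{\mathsf{L}} B \vdash_{\mathsf{L}} C$, ($\pi^{\mathsf{R}}$) $A \vdash_{\mathsf{L}} B \multimap^{\mathsf{R}} C$ iff $A \otimes^{\mathsf{R}} B \vdash_{\mathsf{L}} C$. A ternary frame is $\langle W,\leq,\mathbb{I},\mathbb{L}\rangle$ with $W$ a set, $\leq$ a preorder on $W$, $\mathbb{I}\subseteq W$ downward closed, and $\mathbb{L}\subseteq W^3$ upward closed in its first two arguments and downward closed in its third (if $\mathbb{L}abc$, $a\le a'$, $b\le b'$, $c'\le c$ then $\mathbb{L}a'b'c'$). A $\mathtt{SkMBiCA}$ frame is $\langle W,\leq,\mathbb{I},\mathbb{L},\mathbb{R}\rangle$ where $\mathbb{L},\mathbb{R}$ are both such ternary relations, satisfying: ($\mathbb{LR}$-reverse) $\mathbb{L}abc \iff \mathbb{R}bac$ for all $a,b,c$; (LSA)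 for all $a,b,c,d,x$, if $\mathbb{L}abx$ and $\mathbb{L}xcd$ then there is $y$ with $\mathbb{L}bcy$ and $\mathbb{L}ayd$; (LSLU) for all $a,b\in W$, $e\in\mathbb{I}$, $\mathbb{L}eab$ implies $b\le a$; (LSRU) for all $a\in W$ there is $e\in\mathbb{I}$ with $\mathbb{L}aea$. A valuation is a function $v$ from formulae to downward closed subsets of $W$ with $v(\mathsf{I})=\mathbb{I}$, $v(A\otimes^{\mathsf{L}} B) = \{c : \exists a\in v(A), b\in v(B), \mathbb{L}abc\}$, $v(A\multimap^{\mathsf{L}} B)=\{c : \forall a\in v(A), b\in W, \mathbb{L}cab \Rightarrow b\in v(B)\}$, and the same two clauses for $\otimes^{\mathsf{R}},\multimap^{\mathsf{R}}$ with $\mathbb{R}$ in place of $\mathbb{L}$. A $\mathtt{SkMBiCA}$ model is a $\mathtt{SkMBiCA}$ frame together with a valuation. *)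

(* Defs.v *)
From Stdlib Require Export Relation_Definitions Ensembles.

Set Implicit Arguments.
Unset Strict Implicit.

Inductive formula (Atom : Type) : Type :=
  | Var (X : Atom)
  | Unit
  | TensorL (A B : formula Atom)
  | LolliL (A B : formula Atom)
  | TensorR (A B : formula Atom)
  | LolliR (A B : formula Atom).

Arguments Unit {Atom}.

Declare Scope skew_scope.
Delimit Scope skew_scope with skew.
Bind Scope skew_scope with formula.

Notation "A ⊗L B" := (TensorL A B) (at level 40, left associativity) : skew_scope.
Notation "A ⊗R B" := (TensorR A B) (at level 40, left associativity) : skew_scope.
Notation "A ⊸L B" := (LolliL A B) (at level 55, right associativity) : skew_scope.
Notation "A ⊸R B" := (LolliR A B) (at level 55, right associativity) : skew_scope.

Reserved Notation "A ⊢L B" (at level 70, no associativity).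

Open Scope skew_scope.

(* There is deliberately no monotonicity rule for [⊗R]: it is derivable via
   [gamma] and [gamma_inv]. *)
Inductive derivable (Atom : Type) : formula Atom -> formula Atom -> Prop :=
  | der_id A : A ⊢L A
  | der_comp A B C : A ⊢L B -> B ⊢L C -> A ⊢L C
  | der_tensorL A B C D : A ⊢L C -> B ⊢L D -> A ⊗L B ⊢L C ⊗L D
  | der_lolliL A B C D : C ⊢L A -> B ⊢L D -> A ⊸L B ⊢L C ⊸L D
  | der_lolliR A B C D : C ⊢L A -> B ⊢L D -> A ⊸R B ⊢L C ⊸R D
  | der_lambda A : Unit ⊗L A ⊢L A
  | der_rho A : A ⊢L A ⊗L Unit
  | der_alpha A B C : (A ⊗L B) ⊗L C ⊢L A ⊗L (B ⊗L C)
  | der_gamma A B : A ⊗L B ⊢L B ⊗R A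
  | der_gamma_inv A B : A ⊗R B ⊢L B ⊗L A
  | der_pi A B C : A ⊗L B ⊢L C -> A ⊢L B ⊸L C
  | der_pi_inv A B C : A ⊢L B ⊸L C -> A ⊗L B ⊢L C
  | der_piR A B C : A ⊗R B ⊢L C -> A ⊢L B ⊸R C
  | der_piR_inv A B C : A ⊢L B ⊸R C -> A ⊗R B ⊢L C
where "A ⊢L B" := (derivable A B) : skew_scope.

Definition downward_closed (W : Type) (le : relation W) (S : Ensemble W) : Prop :=
  forall a b : W, le a b -> In W S b -> In W S a.

Record ternary_frame (W : Type) (le : relation W) (I : Ensemble W)
    (L : W -> W -> W -> Prop) : Prop := {
  tf_preorder : preorder W le;
  tf_unit_closed : downward_closed le I;
  tf_rel_closed : forall a b c a' b' c' : W,
    L a b c -> le a a' -> le b b' -> le c' c -> L a' b' c'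
}.

Record SkMBiCA_frame : Type := {
  world :> Type;
  fle : relation world;
  funit : Ensemble world;
  frelL : world -> world -> world -> Prop;
  frelR : world -> world -> world -> Prop;
  frame_ternaryL : ternary_frame fle funit frelL;
  frame_ternaryR : ternary_frame fle funit frelR;
  frame_LR_reverse : forall a b c : world, frelL a b c <-> frelR b a c;
  frame_LSA : forall a b c d x : world,
    frelL a b x -> frelL x c d -> exists y : world, frelL b c y /\ frelL a y d;
  frame_LSLU : forall a b e : world, In world funit e -> frelL e a b -> fle b a;
  frame_LSRU : forall a : world, exists e : world, In world funit e /\ frelL a e a
}.

Arguments fle : clear implicits.
Arguments funit : clear implicits.
Arguments frelL : clear implicits.
Arguments frelR : clear implicits.

Definition tensor_set (W : Type) (T : W -> W -> W -> Prop) (P Q : Ensemble W) :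
    Ensemble W :=
  fun c => exists a b : W, In W P a /\ In W Q b /\ T a b c.

Definition lolli_set (W : Type) (T : W -> W -> W -> Prop) (P Q : Ensemble W) :
    Ensemble W :=
  fun c => forall a b : W, In W P a -> T c a b -> In W Q b.

(* Equality of subsets is extensional ([Same_set]). *)
Record valuation (Atom : Type) (F : SkMBiCA_frame)
    (v : formula Atom -> Ensemble F) : Prop := {
  val_closed : forall A, downward_closed (fle F) (v A);
  val_unit : Same_set F (v Unit) (funit F);
  val_tensorL : forall A B,
    Same_set F (v (A ⊗L B)) (tensor_set (frelL F) (v A) (v B));
  val_lolliL : forall A B,
    Same_set F (v (A ⊸L B)) (lolli_set (frelL F) (v A) (v B));
  val_tensorR : forall A B,
    Same_set F (v (A ⊗R B)) (tensor_set (frelR F) (v A) (v B));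
  val_lolliR : forall A B,
    Same_set F (v (A ⊸R B)) (lolli_set (frelR F) (v A) (v B))
}.

Record SkMBiCA_model (Atom : Type) : Type := {
  model_frame :> SkMBiCA_frame;
  model_val : formula Atom -> Ensemble model_frame;
  model_valP : valuation model_val
}.

Arguments model_val {Atom} _ _ _.

Definition valid_in (Atom : Type) (M : SkMBiCA_model Atom) (A B : formula Atom) :
    Prop :=
  Included M (model_val M A) (model_val M B).

(* Main.v *)
Require Import Defs.

(** Soundness is proved by induction on the derivation, in the algebra of subsets of a frame ordered
    by inclusion. Each ternary relation induces a monotone product with a right adjoint, which is
    antitone in its first argument; this gives the monotonicity rules and both residuation rules.
    The structural axioms match the frame conditions: LSLU gives lambda, LSRU gives rho, LSA gives
    alpha, and LR-reverse gives gamma and its inverse. *)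

Lemma tensor_set_mono (W : Type) (T : W -> W -> W -> Prop) (P P' Q Q' : Ensemble W) :
  Included W P P' -> Included W Q Q' ->
  Included W (tensor_set T P Q) (tensor_set T P' Q').
Proof.
intros HP HQ c (a & b & Ha & Hb & Hc).
exists a, b; auto.
Qed.

Lemma lolli_set_mono (W : Type) (T : W -> W -> W -> Prop) (P P' Q Q' : Ensemble W) :
  Included W P' P -> Included W Q Q' ->
  Included W (lolli_set T P Q) (lolli_set T P' Q').
Proof.
intros HP HQ c Hc a b Ha Hb.
exact (HQ b (Hc a b (HP a Ha) Hb)).
Qed.

(** Both sides say that [T a b c] with [a] in [P] and [b] in [Q] forces [c] in [S]. As [T] is
    arbitrary, this covers pi and piR in both directions. *)
Lemma tensor_lolli_adjoint (W : Type) (T : W -> W -> W -> Prop) (P Q S : Ensemble W) :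
  Included W (tensor_set T P Q) S <-> Included W P (lolli_set T Q S).
Proof.
split; intros H c Hc.
- intros a b Ha Hb. apply H. exists c, a; auto.
- destruct Hc as (a & b & Ha & Hb & Hc). exact (H a Ha b c Hb Hc).
Qed.

(** Asking for one implication only lets each half of LR-reverse yield one of gamma and its
    inverse. *)
Lemma tensor_set_reverse (W : Type) (T T' : W -> W -> W -> Prop) (P Q : Ensemble W) :
  (forall a b c, T a b c -> T' b a c) ->
  Included W (tensor_set T P Q) (tensor_set T' Q P).
Proof.
intros H c (a & b & Ha & Hb & Hc).
exists b, a; auto.
Qed.

Lemma Included_trans (W : Type) (P Q S : Ensemble W) :
  Included W P Q -> Included W Q S -> Included W P S.
Proof. intros H K x Hx. exact (K x (H x Hx)). Qed.

(** A valuation satisfies its clauses only up to [Same_set]; this moves an inclusion between the set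
    operations back to the values of formulae. *)
Lemma Included_Same_set (W : Type) (P P' Q Q' : Ensemble W) :
  Same_set W P P' -> Same_set W Q Q' -> Included W P' Q' -> Included W P Q.
Proof.
intros [HP _] [_ HQ] H.
exact (Included_trans _ _ _ _ HP (Included_trans _ _ _ _ H HQ)).
Qed.

Lemma Same_set_refl (W : Type) (P : Ensemble W) : Same_set W P P.
Proof. split; intros x Hx; exact Hx. Qed.

(** LSLU only places [c] below [a], so downward closure carries membership from [a] to [c]. *)
Lemma tensor_set_lunit (F : SkMBiCA_frame) (P : Ensemble F) :
  downward_closed (fle F) P ->
  Included F (tensor_set (frelL F) (funit F) P) P.
Proof.
intros HP c (e & a & He & Ha & Hc).
exact (HP c a (frame_LSLU He Hc) Ha).
Qed.

Lemma tensor_set_runit (F : SkMBiCA_frame) (P : Ensemble F) :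
  Included F P (tensor_set (frelL F) P (funit F)).
Proof.
intros a Ha. destruct (frame_LSRU a) as (e & He & Hae).
exists a, e; auto.
Qed.

Lemma tensor_set_assoc (F : SkMBiCA_frame) (P Q S : Ensemble F) :
  Included F (tensor_set (frelL F) (tensor_set (frelL F) P Q) S)
    (tensor_set (frelL F) P (tensor_set (frelL F) Q S)).
Proof.
intros d (x & c & (a & b & Ha & Hb & Hx) & Hc & Hd).
destruct (frame_LSA Hx Hd) as (y & Hy & Hay).
exists a, y; repeat split; trivial.
exists b, c; auto.
Qed.

Theorem mainTheorem7 (Atom : Type) (A B : formula Atom) :
  A ⊢L B -> forall M : SkMBiCA_model Atom, valid_in M A B.
Proof.
intros H [F v V]; unfold valid_in; simpl.
pose proof (val_tensorL V) as VtL. pose proof (val_tensorR V) as VtR.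
pose proof (val_lolliL V) as VlL. pose proof (val_lolliR V) as VlR.
pose proof (fun P => Same_set_refl F P) as Vr.
induction H as
  [ A | A B C _ IH1 _ IH2 | A B C D _ IH1 _ IH2 | A B C D _ IH1 _ IH2
  | A B C D _ IH1 _ IH2 | A | A | A B C | A B | A B
  | A B C _ IH | A B C _ IH | A B C _ IH | A B C _ IH ].
- exact (fun x Hx => Hx).
- exact (Included_trans _ _ _ _ IH1 IH2).
- exact (Included_Same_set _ _ _ _ _ (VtL _ _) (VtL _ _)
    (tensor_set_mono _ _ _ _ _ _ IH1 IH2)).
- exact (Included_Same_set _ _ _ _ _ (VlL _ _) (VlL _ _)
    (lolli_set_mono _ _ _ _ _ _ IH1 IH2)).
- exact (Included_Same_set _ _ _ _ _ (VlR _ _) (VlR _ _)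
    (lolli_set_mono _ _ _ _ _ _ IH1 IH2)).
- apply (Included_Same_set _ _ _ _ _ (VtL _ _) (Vr _)).
  apply (fun K => Included_trans _ _ _ _ K (tensor_set_lunit _ _ (val_closed V (A:=A)))).
  apply tensor_set_mono; [apply (val_unit V) | apply Vr].
- apply (Included_Same_set _ _ _ _ _ (Vr _) (VtL _ _)).
  apply (Included_trans _ _ _ _ (tensor_set_runit F (v A))).
  apply tensor_set_mono; [apply Vr | apply (val_unit V)].
- apply (Included_Same_set _ _ _ _ _ (VtL _ _) (VtL _ _)).
  (* The outer tensors are unfolded; the inner ones are unfolded under monotonicity, on either side
     of associativity. *)
  apply (Included_trans _ _ (tensor_set (frelL F) (tensor_set (frelL F) (v A) (v B)) (v C))).
  { apply tensor_set_mono; [apply VtL | apply Vr]. }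
  apply (Included_trans _ _ _ _ (tensor_set_assoc _ _ _ _)).
  apply tensor_set_mono; [apply Vr | apply VtL].
- apply (Included_Same_set _ _ _ _ _ (VtL _ _) (VtR _ _)).
  apply tensor_set_reverse. intros a b c. apply frame_LR_reverse.
- apply (Included_Same_set _ _ _ _ _ (VtR _ _) (VtL _ _)).
  apply tensor_set_reverse. intros a b c. apply frame_LR_reverse.
- apply (Included_Same_set _ _ _ _ _ (Vr _) (VlL _ _)).
  apply tensor_lolli_adjoint.
  exact (Included_trans _ _ _ _ (proj2 (VtL _ _)) IH).
- apply (Included_Same_set _ _ _ _ _ (VtL _ _) (Vr _)).
  apply tensor_lolli_adjoint.
  exact (Included_trans _ _ _ _ IH (proj1 (VlL _ _))).
- apply (Included_Same_set _ _ _ _ _ (Vr _) (VlR _ _)).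
  apply tensor_lolli_adjoint.
  exact (Included_trans _ _ _ _ (proj2 (VtR _ _)) IH).
- apply (Included_Same_set _ _ _ _ _ (VtR _ _) (Vr _)).
  apply tensor_lolli_adjoint.
  exact (Included_trans _ _ _ _ IH (proj1 (VlR _ _))).
Qed.
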